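(* Let $L = [\ell_1,\dots,\ell_K]^T$ be an observation operator with distinct sensors $\ell_k\in\mathcal{L}$, let $\ell\in\mathcal{L}$ be a further sensor distinct from $\ell_1,\dots,\ell_K$, and let $[L,\ell] := [\ell_1,\dots,\ell_K,\ell]^T:\mathcal{X}\to\mathbb{R}^{K+1}$ be the expanded operator. Write its noise covariance matrix in block form $$\Sigma_{[L,\ell]} = \begin{pmatrix}\Sigma_L & \mathbf{v}_{L,\ell}\\ \mathbf{v}_{L,\ell}^T & v_{\ell,\ell}\end{pmatrix},\qquad \mathbf{v}_{L,\ell}\in\mathbb{R}^K,\ v_{\ell,\ell}\in\mathbb{R},$$ let $\Sigma_L = \mathbf{C}_L\mathbf{C}_L^T$ be the Cholesky decomposition of $\Sigma_L$, and set $$\mathbf{c}_{L,\ell} := \mathbf{C}_L^{-1}\mathbf{v}_{L,\ell},\qquad c_{\ell,\ell} := \sqrt{v_{\ell,\ell} - \mathbf{c}_{L,\ell}^T\mathbf{c}_{L,\ell}},\qquad \mathbf{r}_{L,\ell} := -\tfrac{1}{c_{\ell,\ell}}\,\Sigma_L^{-1}\mathbf{v}_{L,\ell}.$$ Then $c_{\ell,\ell}$ is well-defined and strictly positive, and for every $x\in\mathcal{X}$, $$\big\|[L,\ell](x)\big\|_{\Sigma_{[L,\ell]}^{-1}}^2 = \|Lx\|_{\Sigma_L^{-1}}^2 + \left(\mathbf{r}_{L,\ell}^T\,Lx + \ell(x)/c_{\ell,\ell}\right)^2 \;\ge\; \|Lx\|_{\Sigma_L^{-1}}^2 .$$ Consequently,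 the continuity coefficient $\gamma_L$ and, for every $\theta\in\mathcal{P}$, the observability coefficients $\beta_G(\theta)$ and $\beta_{L|\mathcal{W}}(\theta)$ do not decrease when $L$ (with norm $\|\cdot\|_{\Sigma_L^{-1}}$) is replaced by $[L,\ell]$ (with norm $\|\cdot\|_{\Sigma_{[L,\ell]}^{-1}}$).
   Context: Setting. $\mathcal{X}$ is a real Hilbert space with norm $\|\cdot\|_{\mathcal{X}}$ and dual $\mathcal{X}'$; $\mathcal{P} \subset \mathbb{R}^p$ is a compact set of hyper-parameters. For each $\theta\in\mathcal{P}$ there is a linear map $\mathbf{u}\mapsto x_\theta(\mathbf{u})$ from $\mathbb{R}^M$ to $\mathcal{X}$. $\Sigma_{\mathrm{pr}}\in\mathbb{R}^{M\times M}$ is symmetric positive definite, and $\|\mathbf{u}\|_{\Sigma_{\mathrm{pr}}^{-1}}^2 := \mathbf{u}^T\Sigma_{\mathrm{pr}}^{-1}\mathbf{u}$. The states are uniformly bounded: there is $\bar\eta>0$ with $\sup_{\mathbf{u}\neq 0} \|x_\theta(\mathbf{u})\|_{\mathcal{X}} / \|\mathbf{u}\|_{\Sigma_{\mathrm{pr}}^{-1}} < \bar\eta$ for all $\theta\in\mathcal{P}$. Sensors and noise. $\mathcal{L}\subset\mathcal{X}'$ is a library of sensors, equipped with a symmetric noise covariance function $\mathbf{cov}:\mathcal{L}\times\mathcal{L}\to\mathbb{R}$. An observation operator is $L = [\ell_1,\dots,\ell_K]^T:\mathcal{X}\to\mathbb{R}^K$, $Lx=[\ell_1(x),\dots,\ell_K(x)]^T$,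 with distinct $\ell_k\in\mathcal{L}$; its noise covariance matrix $\Sigma_L\in\mathbb{R}^{K\times K}$ is defined by $[\sigma^2\Sigma_L]_{i,j} := \mathbf{cov}(\ell_j,\ell_i)$, with a fixed scaling parameter $\sigma^2>0$. It is assumed that $\Sigma_L$ is symmetric positive definite for every combination of (distinct) sensors in $\mathcal{L}$. The data norm is $\|\mathbf{d}\|_{\Sigma_L^{-1}}^2 := \mathbf{d}^T\Sigma_L^{-1}\mathbf{d}$. Coefficients (infima and suprema of quotients are over nonzero elements): $$\gamma_L := \sup_{x\in\mathcal{X}} \frac{\|Lx\|_{\Sigma_L^{-1}}}{\|x\|_{\mathcal{X}}},\quad \beta_G(\theta) := \inf_{\mathbf{u}\in\mathbb{R}^M}\frac{\|Lx_\theta(\mathbf{u})\|_{\Sigma_L^{-1}}}{\|\mathbf{u}\|_{\Sigma_{\mathrm{pr}}^{-1}}},\quad \beta_{L|\mathcal{W}}(\theta) := \inf_{x\in\mathcal{W}_\theta}\frac{\|Lx\|_{\Sigma_L^{-1}}}{\|x\|_{\mathcal{X}}},$$ where $\mathcal{W}_\theta := \{x_\theta(\mathbf{u}) : \mathbf{u}\in\mathbb{R}^M\}$. *)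

(* Defs.v *)
From HB Require Import structures.
From mathcomp Require Export all_boot all_order all_algebra.
From mathcomp Require Export all_classical all_reals all_analysis.

Set Implicit Arguments.
Unset Strict Implicit.
Unset Printing Implicit Defensive.

Export Order.TTheory GRing.Theory Num.Theory.
Export numFieldNormedType.Exports.

Local Open Scope classical_set_scope.
Local Open Scope ring_scope.

Definition sym_posdef (R : realType) (n : nat) (S : 'M[R]_n) : Prop :=
  S^T = S /\ forall u : 'cV[R]_n, u != 0 -> 0 < (u^T *m S *m u) 0 0.

(* The norm weighted by the inverse of [S]: [inv_norm S d ^+ 2] is
   d^T S^-1 d when [S] is symmetric positive definite. *)
Definition inv_norm (R : realType) (n : nat) (S : 'M[R]_n) (d : 'cV[R]_n) : R :=
  Num.sqrt ((d^T *m invmx S *m d) 0 0).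

(* [is_trig_mx] means lower triangular; the positive diagonal makes the
   factor unique. *)
Definition is_cholesky (R : realType) (n : nat) (S C : 'M[R]_n) : Prop :=
  [/\ is_trig_mx C, forall i, 0 < C i i & S = C *m C^T].

Definition dual_space (R : realType) (X : normedModType R) : set (X -> R) :=
  [set f : X -> R | scalar f /\ continuous f].
Arguments dual_space {R} X _.

Section Observation.
Variables (R : realType) (X : normedModType R).
Implicit Types (K : nat) (l : X -> R).

Definition observe K (L : 'I_K -> X -> R) (x : X) : 'cV[R]_K :=
  \col_k L k x.

Definition expand K (L : 'I_K -> X -> R) l : 'I_(K + 1) -> X -> R :=
  fun i => match fintype.split i with inl k => L k | inr _ => l end.

Variables (cov : (X -> R) -> (X -> R) -> R) (sigma : R).

Definition noise_cov K (L : 'I_K -> X -> R) : 'M[R]_K :=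
  \matrix_(i, j) (cov (L j) (L i) / sigma ^+ 2).

Definition data_norm K (L : 'I_K -> X -> R) (d : 'cV[R]_K) : R :=
  inv_norm (noise_cov L) d.

(* The coefficients are extended reals, so that suprema and infima carry no
   default value. *)
Definition gamma_L K (L : 'I_K -> X -> R) : \bar R :=
  ereal_sup [set (data_norm L (observe L x) / `|x|)%:E | x in [set x | x != 0]].

Definition beta_G M (Spr : 'M[R]_M) (xs : 'cV[R]_M -> X)
    K (L : 'I_K -> X -> R) : \bar R :=
  ereal_inf [set (data_norm L (observe L (xs u)) / inv_norm Spr u)%:E
            | u in [set u | u != 0]].

Definition beta_W (W : set X) K (L : 'I_K -> X -> R) : \bar R :=
  ereal_inf [set (data_norm L (observe L x) / `|x|)%:E
            | x in W `&` [set x | x != 0]].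

End Observation.

(* Main.v *)
Require Import Defs.
From mathcomp Require Import ring.

Set Implicit Arguments.
Unset Strict Implicit.
Unset Printing Implicit Defensive.

Local Open Scope classical_set_scope.
Local Open Scope ring_scope.

(** Adding a sensor borders the noise covariance matrix with one row and one
    column, so everything reduces to the effect of a border on an inverse
    quadratic form. Block elimination shows that the inverse form of the
    bordered matrix at [(y, z)] is the inverse form of [A] at [y] plus
    [(z - v^T A^-1 y)^2 / schur], where [schur = s - v^T A^-1 v] is the Schur
    complement ([form_invmx_bordered]). Positive definiteness of the bordered
    matrix makes [schur] positive ([schur_gt0]), so the added term is a
    nonnegative square.

    The Cholesky factor only renames these quantities: by [cholesky_form],
    [c^T c = v^T S_L^-1 v], hence [cll ^+ 2] is the Schur complement, and
    [r^T y + z / cll = (z - v^T S_L^-1 y) / cll]. The coefficients involve the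
    data norm only in the numerator of each quotient, so they inherit the
    pointwise inequality. *)

Section PositiveDefinite.
Variables (R : realType) (n : nat).
Implicit Types (S : 'M[R]_n) (u v : 'cV[R]_n).

Lemma sym_posdef_unitmx S : sym_posdef S -> S \in unitmx.
Proof.
move=> [_ Spos]; rewrite -row_free_unit; apply: inj_row_free => w wS0.
apply/eqP; apply: contraT => w_neq0.
have := Spos w^T; rewrite trmx_eq0 trmxK wS0 mul0mx mxE ltxx.
by move=> /(_ w_neq0).
Qed.

Lemma trmx_invmx_sym S : S^T = S -> (invmx S)^T = invmx S.
Proof. by move=> Ssym; rewrite trmx_inv Ssym. Qed.

Lemma form_invmxC S u v : S^T = S ->
  (u^T *m invmx S *m v) 0 0 = (v^T *m invmx S *m u) 0 0.
Proof.
(* A 1 x 1 matrix is its own transpose, so the entry may be read off there. *)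
move=> Ssym; rewrite -[LHS](mxE trmx_key (fun i j => _ j i)) -/(trmx _).
by rewrite !trmx_mul trmxK trmx_invmx_sym // mulmxA.
Qed.

(** The form of the inverse at [u] is the form of [S] at [S^-1 u]. *)
Lemma form_invmx_ge0 S u : sym_posdef S -> 0 <= (u^T *m invmx S *m u) 0 0.
Proof.
move=> Spd; have [Ssym Spos] := Spd; have Su := sym_posdef_unitmx Spd.
have -> : u^T *m invmx S *m u = (invmx S *m u)^T *m S *m (invmx S *m u).
  by rewrite trmx_mul trmx_invmx_sym // -!mulmxA mulKVmx.
have [->|Su_neq0] := eqVneq (invmx S *m u) 0; first by rewrite mulmx0 mxE.
exact/ltW/Spos.
Qed.

Lemma inv_norm_sqr S u : sym_posdef S ->
  inv_norm S u ^+ 2 = (u^T *m invmx S *m u) 0 0.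
Proof. by move=> Spd; rewrite sqr_sqrtr // form_invmx_ge0. Qed.

End PositiveDefinite.

Section Bordered.
Variables (R : realType) (n : nat) (A : 'M[R]_n) (v : 'cV[R]_n) (s : R).
Let S : 'M[R]_(n + 1) := block_mx A v v^T s%:M.
Let schur := s - (v^T *m invmx A *m v) 0 0.

(** The Schur complement is the value of the bordered form at the vector
    with blocks [- A^-1 v] and [1], on which the first block row vanishes. *)
Lemma schur_gt0 : sym_posdef A -> sym_posdef S -> 0 < schur.
Proof.
move=> Apd [_ Spos]; have Au := sym_posdef_unitmx Apd.
pose u : 'cV[R]_(n + 1) := col_mx (- (invmx A *m v)) 1%:M.
have u_neq0 : u != 0.
  apply/eqP => /(congr1 dsubmx); rewrite col_mxKd => /matrixP/(_ 0 0).
  by rewrite !mxE => /eqP; rewrite oner_eq0.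
have := Spos u u_neq0; rewrite -mulmxA mul_block_col !mulmxN mulKVmx //.
rewrite !mulmx1 addNr tr_col_mx mul_row_col mulmx0 add0r trmx1 mul1mx.
rewrite mulmxA /schur; set q := _ *m v.
by rewrite !mxE mulr1n addrC.
Qed.

(** Block elimination solves [S w = (y, z)] with last entry
    [t = (z - v^T A^-1 y) / schur] and first block [A^-1 (y - t v)]; pairing
    [w] with [(y, z)] completes the square. *)
Lemma form_invmx_bordered (y : 'cV[R]_n) (z : R) :
  sym_posdef A -> sym_posdef S ->
  ((col_mx y z%:M)^T *m invmx S *m col_mx y z%:M) 0 0
    = (y^T *m invmx A *m y) 0 0
      + (z - (v^T *m invmx A *m y) 0 0) ^+ 2 / schur.
Proof.
move=> Apd Spd; have [Asym _] := Apd.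
have Au := sym_posdef_unitmx Apd; have Su := sym_posdef_unitmx Spd.
have schur_neq0 := lt0r_neq0 (schur_gt0 Apd Spd).
pose b := (v^T *m invmx A *m y) 0 0; pose t := (z - b) / schur.
pose w : 'cV[R]_(n + 1) := col_mx (invmx A *m (y - t *: v)) t%:M.
have Sw : S *m w = col_mx y z%:M.
  rewrite mul_block_col mulKVmx // mul_mx_scalar subrK; congr col_mx.
  rewrite mulmxA mulmxBr -scalemxAr [v^T *m _ *m y]mx11_scalar.
  rewrite [v^T *m _ *m v]mx11_scalar -/b scale_scalar_mx -scalar_mxM.
  rewrite -raddfB -raddfD; congr (_%:M).
  (* Here [v^T A^-1 v] is traded for [s - schur], to cancel the denominator. *)
  rewrite (_ : _ 0 0 = s - schur); last by rewrite /schur; ring.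
  by rewrite /= /t; field.
rewrite -mulmxA -{2}Sw mulKmx // tr_col_mx mul_row_col tr_scalar_mx.
rewrite mulmxA mulmxBr -scalemxAr -scalar_mxM [y^T *m _ *m v]mx11_scalar.
rewrite (form_invmxC y v Asym) -/b !mxE /= !mulr1n -/b /t.
by field.
Qed.

End Bordered.

Section Cholesky.
Variables (R : realType) (n : nat) (S C : 'M[R]_n).
Hypothesis chol : is_cholesky S C.

Lemma cholesky_unitmx : C \in unitmx.
Proof.
have [Ctrig Cpos _] := chol; rewrite unitmxE det_trig // unitfE.
by apply/prodf_neq0 => i _; rewrite lt0r_neq0.
Qed.

(** [S^-1 = C^-T C^-1], which is the form in which the Cholesky factor enters
    the Schur complement. *)
Lemma cholesky_form (v : 'cV[R]_n) :
  (invmx C *m v)^T *m (invmx C *m v) = v^T *m invmx S *m v.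
Proof.
have Cu := cholesky_unitmx; have CTu : C^T \in unitmx by rewrite unitmx_tr.
have [_ _ SE] := chol.
have Su : S \in unitmx by rewrite SE unitmx_mul Cu.
have -> : invmx S = invmx C^T *m invmx C.
  rewrite -[RHS](mulKmx Su) {3}SE -mulmxA (mulKVmx CTu).
  by rewrite mulmxV // mulmx1.
by rewrite trmx_mul trmx_inv !mulmxA.
Qed.

End Cholesky.

Section Expansion.
Variables (R : realType) (X : normedModType R) (K : nat).
Variables (L : 'I_K -> X -> R) (l : X -> R).
Variables (cov : (X -> R) -> (X -> R) -> R) (sigma : R).

Lemma expand_lshift k : expand L l (lshift 1 k) = L k.
Proof. by rewrite /expand (unsplitK (inl k)). Qed.

Lemma expand_rshift k : expand L l (rshift K k) = l.
Proof. by rewrite /expand (unsplitK (inr k)). Qed.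

Lemma expand_inj : injective L -> (forall k, L k <> l) ->
  injective (expand L l).
Proof.
move=> Linj fresh i j.
case: (split_ordP i) => a ->; case: (split_ordP j) => b ->;
  rewrite ?expand_lshift ?expand_rshift.
- by move/Linj->.
- by move/fresh.
- by move/esym/fresh.
- by rewrite !ord1.
Qed.

Lemma observe_expand x :
  observe (expand L l) x = col_mx (observe L x) (l x)%:M.
Proof.
rewrite -[LHS]vsubmxK; congr col_mx; apply/matrixP => i j.
  by rewrite !mxE expand_lshift.
by rewrite !mxE expand_rshift !ord1.
Qed.

(** Symmetry identifies the lower left block; the other blocks are read off
    from [expand]. *)
Lemma noise_cov_expand : let S := noise_cov cov sigma (expand L l) in
  S^T = S ->
  S = block_mx (noise_cov cov sigma L) (ursubmx S) (ursubmx S)^T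
        (drsubmx S 0 0)%:M.
Proof.
move=> S Ssym; rewrite -mx11_scalar trmx_ursub Ssym -[LHS]submxK.
congr block_mx; apply/matrixP => i j.
by rewrite !mxE !expand_lshift.
Qed.

End Expansion.

Section Monotonicity.
Variables (R : realType) (X : normedModType R).
Variables (cov : (X -> R) -> (X -> R) -> R) (sigma : R) (m n : nat).
Variables (L : 'I_m -> X -> R) (L' : 'I_n -> X -> R).
Hypothesis le_data : forall x,
  data_norm cov sigma L (observe L x) <= data_norm cov sigma L' (observe L' x).

Lemma le_gamma_L : (gamma_L cov sigma L <= gamma_L cov sigma L')%E.
Proof.
apply: ge_ereal_sup => _ [x x_neq0 <-].
apply: le_trans (ereal_sup_ubound _); last by exists x.
by rewrite lee_fin ler_wpM2r // invr_ge0.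
Qed.

Lemma le_beta_G M (Spr : 'M[R]_M) (xs : 'cV[R]_M -> X) :
  (beta_G cov sigma Spr xs L <= beta_G cov sigma Spr xs L')%E.
Proof.
apply: le_ereal_inf_tmp => _ [u u_neq0 <-].
apply: le_trans (ereal_inf_lbound _) _; first by exists u.
by rewrite lee_fin ler_wpM2r // invr_ge0 sqrtr_ge0.
Qed.

Lemma le_beta_W (W : set X) :
  (beta_W cov sigma W L <= beta_W cov sigma W L')%E.
Proof.
apply: le_ereal_inf_tmp => _ [x Wx <-].
apply: le_trans (ereal_inf_lbound _) _; first by exists x.
by rewrite lee_fin ler_wpM2r // invr_ge0.
Qed.

End Monotonicity.

Theorem mainTheorem5 (R : realType)
  (* the real Hilbert space *)
  (X : completeNormedModType R) (ip : {dot X for idfun})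
  (norm_ip : forall x : X, `|x| ^+ 2 = ip x x)
  (* hyper-parameters, prior and states *)
  (p M : nat) (P : set 'rV[R]_p) (compactP : compact P)
  (xs : 'rV[R]_p -> 'cV[R]_M -> X)
  (linear_xs : forall theta, P theta -> linear (xs theta))
  (Spr : 'M[R]_M) (posdef_Spr : sym_posdef Spr)
  (bounded_xs : exists2 eta : R, 0 < eta &
    forall theta, P theta ->
      (ereal_sup [set (`|xs theta u| / inv_norm Spr u)%:E
                 | u in [set u | u != 0]%R] < eta%:E)%E)
  (* sensor library and noise covariance *)
  (Lib : set (X -> R)) (Lib_dual : Lib `<=` dual_space X)
  (cov : (X -> R) -> (X -> R) -> R)
  (cov_sym : forall l1 l2, Lib l1 -> Lib l2 -> cov l1 l2 = cov l2 l1)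
  (sigma : R) (sigma2_gt0 : 0 < sigma ^+ 2)
  (posdef_noise : forall (n : nat) (L' : 'I_n -> X -> R),
    injective L' -> (forall k, Lib (L' k)) -> sym_posdef (noise_cov cov sigma L'))
  (* the observation operator and the further sensor *)
  (K : nat) (L : 'I_K -> X -> R)
  (distinct_L : injective L) (Lib_L : forall k, Lib (L k))
  (l : X -> R) (Lib_l : Lib l) (fresh_l : forall k, L k <> l) :
  let SL := noise_cov cov sigma L in
  let SLl := noise_cov cov sigma (expand L l) in
  let v : 'cV[R]_K := ursubmx SLl in
  let vll : R := drsubmx SLl 0 0 in
  [/\ SLl = block_mx SL v v^T vll%:M,
      forall C : 'M[R]_K, is_cholesky SL C ->
        let c := invmx C *m v in
        let cll := Num.sqrt (vll - (c^T *m c) 0 0) in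
        let r := - cll^-1 *: (invmx SL *m v) in
        [/\ C \in unitmx,
            0 <= vll - (c^T *m c) 0 0,
            0 < cll &
            forall x : X,
              data_norm cov sigma (expand L l) (observe (expand L l) x) ^+ 2
                = data_norm cov sigma L (observe L x) ^+ 2
                  + ((r^T *m observe L x) 0 0 + l x / cll) ^+ 2
              /\ data_norm cov sigma L (observe L x) ^+ 2
                  <= data_norm cov sigma (expand L l) (observe (expand L l) x) ^+ 2],
      (gamma_L cov sigma L <= gamma_L cov sigma (expand L l))%E &
      forall theta, P theta ->
        (beta_G cov sigma Spr (xs theta) L
           <= beta_G cov sigma Spr (xs theta) (expand L l))%E
        /\ (beta_W cov sigma (range (xs theta)) L
           <= beta_W cov sigma (range (xs theta)) (expand L l))%E].
Proof.
move=> SL SLl v vll.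
have SLpd : sym_posdef SL by exact: posdef_noise.
have SLlpd : sym_posdef SLl.
  apply: posdef_noise; first exact: expand_inj.
  by move=> k; rewrite /expand; case: fintype.split.
have [SLsym _] := SLpd.
have SLlE : SLl = block_mx SL v v^T vll%:M.
  by apply: noise_cov_expand; case: SLlpd.
have Bpd : sym_posdef (block_mx SL v v^T vll%:M) by rewrite -SLlE.
pose schur := vll - (v^T *m invmx SL *m v) 0 0.
have schur_pos : 0 < schur by exact: schur_gt0.
have normE x : data_norm cov sigma (expand L l) (observe (expand L l) x) ^+ 2
    = data_norm cov sigma L (observe L x) ^+ 2
      + (l x - (v^T *m invmx SL *m observe L x) 0 0) ^+ 2 / schur.
  rewrite [LHS]inv_norm_sqr // [in RHS]inv_norm_sqr // -/SL -/SLl.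
  by rewrite SLlE observe_expand form_invmx_bordered.
have norm2_le x : data_norm cov sigma L (observe L x) ^+ 2
    <= data_norm cov sigma (expand L l) (observe (expand L l) x) ^+ 2.
  by rewrite normE lerDl divr_ge0 ?sqr_ge0 // ltW.
have norm_le x : data_norm cov sigma L (observe L x)
    <= data_norm cov sigma (expand L l) (observe (expand L l) x).
  by have := norm2_le x; rewrite ler_pXn2r // nnegrE sqrtr_ge0.
split => //.
- move=> C chol c cll r.
  have schurE : vll - (c^T *m c) 0 0 = schur.
    by rewrite /c (cholesky_form chol).
  have cll_gt0 : 0 < cll by rewrite /cll schurE sqrtr_gt0.
  have cll_sqr : cll ^+ 2 = schur by rewrite sqr_sqrtr schurE // ltW.
  split => //; first exact: cholesky_unitmx chol.
    by rewrite schurE ltW.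
  move=> x; split; last exact: norm2_le.
  rewrite normE; congr (_ + _).
  rewrite linearZ /= trmx_mul trmx_invmx_sym // -scalemxAl -cll_sqr.
  set q := v^T *m _ *m _; rewrite [(_ *: q) 0 0]mxE.
  by field; rewrite lt0r_neq0.
- exact: le_gamma_L.
- by move=> theta _; split; [exact: le_beta_G | exact: le_beta_W].
Qed.
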